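(* For all real numbers $a,b>0$, the following inequalities hold between the differences of means $D_{UV}=U(a,b)-V(a,b)$: $$D_{SA}\le \left\{\begin{array}{l}\tfrac34 D_{SN}\\ \tfrac13 D_{SH}\le \tfrac34 D_{CR}\end{array}\right\}\le \left\{\begin{array}{l}\tfrac37 D_{CN}\le \left\{\begin{array}{l} D_{CS}\\ \tfrac13 D_{CG}\le \tfrac35 D_{RG}\end{array}\right.\\ \tfrac12 D_{SG}\le \tfrac35 D_{RG}\end{array}\right\}\le 3D_{AN}.$$ Explicitly, all of the following hold: (1) $D_{SA}\le \tfrac34 D_{SN}$; (2) $D_{SA}\le \tfrac13 D_{SH}$; (3) $\tfrac13 D_{SH}\le \tfrac34 D_{CR}$; (4) $\tfrac34 D_{CR}\le \tfrac37 D_{CN}$; (5) $\tfrac34 D_{CR}\le \tfrac12 D_{SG}$; (6) $\tfrac34 D_{SN}\le \tfrac37 D_{CN}$; (7) $\tfrac34 D_{SN}\le \tfrac12 D_{SG}$; (8) $\tfrac37 D_{CN}\le D_{CS}$; (9) $D_{CS}\le 3D_{AN}$; (10) $\tfrac37 D_{CN}\le \tfrac13 D_{CG}$; (11) $\tfrac12 D_{SG}\le \tfrac35 D_{RG}$; (12) $\tfrac13 D_{CG}\le \tfrac35 D_{RG}$; (13) $\tfrac35 D_{RG}\le 3D_{AN}$.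
   Context: For real numbers $a,b>0$ define the seven means: arithmetic $A(a,b)=\frac{a+b}{2}$; geometric $G(a,b)=\sqrt{ab}$; harmonic $H(a,b)=\frac{2ab}{a+b}$; Heronian $N(a,b)=\frac{a+\sqrt{ab}+b}{3}$; contra-harmonic $C(a,b)=\frac{a^2+b^2}{a+b}$; root-mean-square $S(a,b)=\sqrt{\frac{a^2+b^2}{2}}$; centroidal $R(a,b)=\frac{2(a^2+ab+b^2)}{3(a+b)}$. For two of these means $U,V$, write $D_{UV}=D_{UV}(a,b)=U(a,b)-V(a,b)$. In the displayed chain, the braces group alternatives: an inequality sign before a brace applies to the first entry of each row, and an inequality sign after a brace applies to the last entry of each row. *)

(* Defs.v *)
From Stdlib Require Import Reals.

Open Scope R_scope.

Definition arithmetic_mean (a b : R) : R := (a + b) / 2.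
Definition geometric_mean (a b : R) : R := sqrt (a * b).
Definition harmonic_mean (a b : R) : R := 2 * a * b / (a + b).
Definition heronian_mean (a b : R) : R := (a + sqrt (a * b) + b) / 3.
Definition contraharmonic_mean (a b : R) : R := (a ^ 2 + b ^ 2) / (a + b).
Definition root_mean_square (a b : R) : R := sqrt ((a ^ 2 + b ^ 2) / 2).
Definition centroidal_mean (a b : R) : R :=
  2 * (a ^ 2 + a * b + b ^ 2) / (3 * (a + b)).

Definition mean_diff (U V : R -> R -> R) (a b : R) : R := U a b - V a b.

Definition D_SA := mean_diff root_mean_square arithmetic_mean.
Definition D_SN := mean_diff root_mean_square heronian_mean.
Definition D_SH := mean_diff root_mean_square harmonic_mean.
Definition D_SG := mean_diff root_mean_square geometric_mean.
Definition D_CR := mean_diff contraharmonic_mean centroidal_mean.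
Definition D_CN := mean_diff contraharmonic_mean heronian_mean.
Definition D_CS := mean_diff contraharmonic_mean root_mean_square.
Definition D_CG := mean_diff contraharmonic_mean geometric_mean.
Definition D_RG := mean_diff centroidal_mean geometric_mean.
Definition D_AN := mean_diff arithmetic_mean heronian_mean.

(* Main.v *)
Require Import Defs.
From Stdlib Require Import Reals Lra.

Open Scope R_scope.

(** Writing m, g, s for the arithmetic, geometric and root-mean-square means and
    q = g^2 / m for the harmonic one, every mean of the chain is linear in
    (m, g, s, q): C = 2m - q, R = (4m - q)/3 and N = (2m + g)/3.  The thirteen
    inequalities are therefore linear consequences of a few inequalities between
    m, g, s and q, which follow from s^2 + g^2 = 2 m^2 after clearing the
    denominator m and squaring. *)

Lemma Rle_of_sqr_le (x y : R) : 0 <= y -> 0 <= y ^ 2 - x ^ 2 -> x <= y.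
Proof. intros hy h; nra. Qed.

Lemma geometric_mean_sqr (a b : R) :
  0 < a -> 0 < b -> geometric_mean a b ^ 2 = a * b.
Proof.
intros ha hb; apply pow2_sqrt, Rlt_le.
now apply Rmult_lt_0_compat.
Qed.

Lemma root_mean_square_sqr (a b : R) :
  root_mean_square a b ^ 2 = (a ^ 2 + b ^ 2) / 2.
Proof. apply pow2_sqrt; nra. Qed.

Lemma geometric_le_arithmetic (a b : R) :
  0 < a -> 0 < b -> geometric_mean a b <= arithmetic_mean a b.
Proof.
intros ha hb.
apply Rle_of_sqr_le; [unfold arithmetic_mean; lra|].
rewrite geometric_mean_sqr by assumption.
unfold arithmetic_mean; pose proof (pow2_ge_0 (a - b)); lra.
Qed.

Lemma heronian_mean_linear (a b : R) :
  heronian_mean a b = (2 * arithmetic_mean a b + geometric_mean a b) / 3.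
Proof. unfold heronian_mean, arithmetic_mean, geometric_mean; field. Qed.

Lemma contraharmonic_mean_linear (a b : R) : 0 < a -> 0 < b ->
  contraharmonic_mean a b = 2 * arithmetic_mean a b - harmonic_mean a b.
Proof.
intros ha hb.
unfold contraharmonic_mean, arithmetic_mean, harmonic_mean; field; lra.
Qed.

Lemma centroidal_mean_linear (a b : R) : 0 < a -> 0 < b ->
  centroidal_mean a b = (4 * arithmetic_mean a b - harmonic_mean a b) / 3.
Proof.
intros ha hb.
unfold centroidal_mean, arithmetic_mean, harmonic_mean; field; lra.
Qed.

Lemma arithmetic_mul_harmonic (a b : R) : 0 < a -> 0 < b ->
  arithmetic_mean a b * harmonic_mean a b = a * b.
Proof.
intros ha hb; unfold arithmetic_mean, harmonic_mean; field; lra.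
Qed.

(** Since [s ^ 2 + g ^ 2 = 2 * m ^ 2], the gap [(2 * m) ^ 2 - (s + g) ^ 2] is exactly
    [(s - g) ^ 2]. *)
Lemma rms_add_geometric_le (m g s : R) :
  0 < m -> s ^ 2 = 2 * m ^ 2 - g ^ 2 ->
  s + g <= 2 * m.
Proof.
intros m_gt0 s_sqr; pose proof (pow2_ge_0 (s - g)); nra.
Qed.

(** Multiplied by [m], the gap between the two sides becomes [(m - g) ^ 2]. *)
Lemma geometric_le_arithmetic_harmonic (m g q : R) :
  0 < m -> m * q = g ^ 2 ->
  2 * g <= m + q.
Proof.
intros m_gt0 mq.
apply Rmult_le_reg_l with m; [assumption|].
pose proof (pow2_ge_0 (m - g)); lra.
Qed.

(** Since [3 * m ^ 2 - g ^ 2 = m ^ 2 + s ^ 2], the gap multiplied by [m] is [(s - m) ^ 2]. *)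
Lemma rms_le_arithmetic_harmonic (m g s q : R) :
  0 < m -> s ^ 2 = 2 * m ^ 2 - g ^ 2 -> m * q = g ^ 2 ->
  2 * s <= 3 * m - q.
Proof.
intros m_gt0 s_sqr mq.
apply Rmult_le_reg_l with m; [assumption|].
pose proof (pow2_ge_0 (s - m)); lra.
Qed.

Lemma arithmetic_geometric_harmonic_le_rms (m g s q : R) :
  0 < m -> 0 <= g -> g <= m -> 0 <= s ->
  s ^ 2 = 2 * m ^ 2 - g ^ 2 -> m * q = g ^ 2 ->
  m + g - q <= s.
Proof.
intros m_gt0 g_ge0 g_le_m s_ge0 s_sqr mq.
apply Rmult_le_reg_l with m; [assumption|].
apply Rle_of_sqr_le; [nra|].
replace ((m * s) ^ 2 - (m * (m + g - q)) ^ 2) with ((m - g) ^ 3 * (m + g)).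
- apply Rmult_le_pos; [apply pow_le|]; lra.
- replace (m * (m + g - q)) with (m ^ 2 + m * g - g ^ 2) by lra.
  rewrite Rpow_mult_distr, s_sqr; ring.
Qed.

(** In terms of means this is [7 * S <= 4 * C + 3 * N], which places [3 / 7 * D_CN] both above
    [3 / 4 * D_SN] and below [D_CS]. *)
Lemma rms_le_contraharmonic_heronian (m g s q : R) :
  0 < m -> 0 <= g -> g <= m -> s ^ 2 = 2 * m ^ 2 - g ^ 2 -> m * q = g ^ 2 ->
  7 * s <= 10 * m + g - 4 * q.
Proof.
intros m_gt0 g_ge0 g_le_m s_sqr mq.
apply Rmult_le_reg_l with m; [assumption|].
apply Rle_of_sqr_le; [nra|].
replace (m * (10 * m + g - 4 * q)) with (10 * m ^ 2 + m * g - 4 * g ^ 2) by lra.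
replace (m * (7 * s)) with (7 * m * s) by ring.
rewrite Rpow_mult_distr, s_sqr.
(* The two sides agree to first order at [g = m], hence the double factor [(m - g) ^ 2]; its
   cofactor has only positive coefficients. *)
replace (_ - _)
  with (2 * ((m - g) ^ 2 * (8 * g ^ 2 + 12 * (m * g) + m ^ 2))) by ring.
assert (0 <= m * g) by nra.
apply Rmult_le_pos; [lra|apply Rmult_le_pos; [apply pow2_ge_0|nra]].
Qed.

(** In terms of means this is [5 * S + G <= 6 * R]; the gap of squares again has a double zero at
    [g = m]. *)
Lemma rms_le_centroidal_geometric (m g s q : R) :
  0 < m -> 0 <= g -> g <= m -> s ^ 2 = 2 * m ^ 2 - g ^ 2 -> m * q = g ^ 2 ->
  5 * s <= 8 * m - 2 * q - g.
Proof.
intros m_gt0 g_ge0 g_le_m s_sqr mq.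
apply Rmult_le_reg_l with m; [assumption|].
apply Rle_of_sqr_le; [nra|].
replace (m * (8 * m - 2 * q - g)) with (8 * m ^ 2 - 2 * g ^ 2 - m * g) by lra.
replace (m * (5 * s)) with (5 * m * s) by ring.
rewrite Rpow_mult_distr, s_sqr.
replace (_ - _)
  with (2 * ((m - g) ^ 2 * (2 * g ^ 2 + 6 * (m * g) + 7 * m ^ 2))) by ring.
assert (0 <= m * g) by nra.
apply Rmult_le_pos; [lra|apply Rmult_le_pos; [apply pow2_ge_0|nra]].
Qed.

Theorem theorem3p1 (a b : R) (ha : 0 < a) (hb : 0 < b) :
  D_SA a b <= 3 / 4 * D_SN a b /\
  D_SA a b <= 1 / 3 * D_SH a b /\
  1 / 3 * D_SH a b <= 3 / 4 * D_CR a b /\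
  3 / 4 * D_CR a b <= 3 / 7 * D_CN a b /\
  3 / 4 * D_CR a b <= 1 / 2 * D_SG a b /\
  3 / 4 * D_SN a b <= 3 / 7 * D_CN a b /\
  3 / 4 * D_SN a b <= 1 / 2 * D_SG a b /\
  3 / 7 * D_CN a b <= D_CS a b /\
  D_CS a b <= 3 * D_AN a b /\
  3 / 7 * D_CN a b <= 1 / 3 * D_CG a b /\
  1 / 2 * D_SG a b <= 3 / 5 * D_RG a b /\
  1 / 3 * D_CG a b <= 3 / 5 * D_RG a b /\
  3 / 5 * D_RG a b <= 3 * D_AN a b.
Proof.
unfold D_SA, D_SN, D_SH, D_SG, D_CR, D_CN, D_CS, D_CG, D_RG, D_AN, mean_diff.
rewrite heronian_mean_linear, contraharmonic_mean_linear, centroidal_mean_linear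
  by assumption.
assert (hm : 0 < arithmetic_mean a b) by (unfold arithmetic_mean; lra).
assert (hg : 0 <= geometric_mean a b) by apply sqrt_pos.
assert (hs : 0 <= root_mean_square a b) by apply sqrt_pos.
assert (hgm := geometric_le_arithmetic a b ha hb).
assert (hmq : arithmetic_mean a b * harmonic_mean a b = geometric_mean a b ^ 2).
{ rewrite geometric_mean_sqr by assumption.
  now apply arithmetic_mul_harmonic. }
assert (hss : root_mean_square a b ^ 2
              = 2 * arithmetic_mean a b ^ 2 - geometric_mean a b ^ 2).
{ rewrite root_mean_square_sqr, geometric_mean_sqr by assumption.
  unfold arithmetic_mean; field. }
revert hm hg hs hgm hmq hss.
(* From here [a] and [b] are forgotten: only the signs, [g <= m] and the two quadratic relations
   remain. *)
generalize (arithmetic_mean a b) (geometric_mean a b) (root_mean_square a b)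
  (harmonic_mean a b).
intros m g s q hm hg hs hgm hmq hss.
assert (h1 : s + g <= 2 * m) by now apply rms_add_geometric_le.
assert (h2 : 2 * g <= m + q) by now apply geometric_le_arithmetic_harmonic.
assert (h3 : 2 * s <= 3 * m - q) by now apply (rms_le_arithmetic_harmonic m g).
assert (h4 : m + g - q <= s) by now apply arithmetic_geometric_harmonic_le_rms.
assert (h5 : 7 * s <= 10 * m + g - 4 * q)
  by now apply rms_le_contraharmonic_heronian.
assert (h6 : 5 * s <= 8 * m - 2 * q - g)
  by now apply rms_le_centroidal_geometric.
(* Each conjunct rearranges to a single bound: (1), (7) to [h1]; (4), (10), (12), (13) to [h2]; (2),
   (3) to [h3]; (5), (9) to [h4]; (6), (8) to [h5]; (11) to [h6]. *)
repeat split; lra.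
Qed.
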